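(* Let $n\ge3$ and let $r$ be an integer with $1\le r\le n-2$. Among all connected simple graphs on $n$ vertices with edge connectivity $r$, the graph $K(n-1,r)$ is the unique graph (up to isomorphism) attaining the minimum distance spectral radius; that is, every connected graph $G$ of order $n$ and edge connectivity $r$ satisfies $\rho(G)\ge\rho(K(n-1,r))$, with equality if and only if $G\cong K(n-1,r)$.
   Context: For a connected simple graph $G$, the distance matrix $D(G)=(d_{uv})_{u,v\in V(G)}$ has $d_{uv}$ equal to the length of a shortest $u$–$v$ path in $G$, and the distance spectral radius $\rho(G)$ is the largest eigenvalue of $D(G)$. The edge connectivity of a connected graph is the minimum number of edges whose removal disconnects the graph. For integers $p\ge q\ge1$, $K(p,q)$ denotes the graph obtained from the complete graph $K_p$ by adding one new vertex and joining it by edges to $q$ vertices of $K_p$. *)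

(* Defs.v *)
From HB Require Import structures.
From mathcomp Require Import all_boot all_order all_algebra.
From mathcomp Require Import boolp classical_sets reals.

Set Implicit Arguments.
Unset Strict Implicit.
Unset Printing Implicit Defensive.

Import Order.TTheory GRing.Theory Num.Theory.

Record sgraph := SGraph {
  vertex :> finType;
  adj : rel vertex;
  adj_sym : symmetric adj;
  adj_irr : irreflexive adj }.

Definition graph_iso (G H : sgraph) : Prop :=
  exists f : G -> H, bijective f /\ (forall x y : G, adj (f x) (f y) = adj x y).

Definition connected_rel (T : finType) (e : rel T) : bool :=
  [forall x, forall y, connect e x y].

Definition connected (G : sgraph) : bool := connected_rel (@adj G).

Definition edges (G : sgraph) : {set {set G}} :=
  [set [set p.1; p.2] | p : G * G & adj p.1 p.2].

Definition del_edges (G : sgraph) (F : {set {set G}}) : rel G :=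
  fun x y => adj x y && ([set x; y] \notin F).

Definition disconnecting (G : sgraph) (F : {set {set G}}) : bool :=
  (F \subset edges G) && ~~ connected_rel (del_edges F).

(* The default [edges G] of the arg min is itself disconnecting as soon as G  *)
(* has at least two vertices.                                                 *)
Definition edge_connectivity (G : sgraph) : nat :=
  #|[arg min_(F < edges G | disconnecting F) #|F| ]|.

Definition upath (G : sgraph) (x y : G) (s : seq G) : bool :=
  [&& path (@adj G) x s, last x s == y & uniq (x :: s)].

(* A sequence [s] with [upath x y s] has [size s] edges, and [size s < #|G|]; *)
(* [dist x y] is the least such size, and #|G| when there is no x-y path.     *)
Definition dist (G : sgraph) (x y : G) : nat :=
  find (fun k => [exists s : k.-tuple G, upath x y s]) (iota 0 #|vertex G|).

Definition dist_mx (R : realType) (G : sgraph) : 'M[R]_#|vertex G| :=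
  (\matrix_(i, j) (dist (enum_val i) (enum_val j))%:R)%R.

(* [dist_mx R G] is symmetric, so for nonempty G its set of real eigenvalues  *)
(* is finite and nonempty, and [sup] is its maximum.                          *)
Definition dist_spectral_radius (R : realType) (G : sgraph) : R :=
  sup [set a : R | eigenvalue (dist_mx R G) a]%classic.

(* [None] is the vertex added to the complete graph on 'I_p; it is joined to  *)
(* the first q vertices of 'I_p.                                              *)
Definition Kadj (p q : nat) : rel (option 'I_p) :=
  fun x y => match x, y with
  | Some i, Some j => i != j
  | Some i, None => i < q
  | None, Some j => j < q
  | None, None => false
  end.

Lemma Kadj_sym p q : symmetric (@Kadj p q).
Proof. by move=> [i|] [j|] //=; rewrite eq_sym. Qed.

Lemma Kadj_irr p q : irreflexive (@Kadj p q).
Proof. by move=> [i|] //=; rewrite eqxx. Qed.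

Definition Kgraph (p q : nat) : sgraph := SGraph (@Kadj_sym p q) (@Kadj_irr p q).

(* Main.v *)
Require Import Defs.
From HB Require Import structures.
From mathcomp Require Import all_boot all_order all_algebra.
From mathcomp Require Import boolp classical_sets reals.
From mathcomp Require Import zify ring lra.

(** For a symmetric matrix A the least c such that c - A is positive
    semidefinite is the largest eigenvalue of A and bounds its Rayleigh
    quotients; if A has positive off-diagonal entries it has a positive
    eigenvector.  Hence deleting edges strictly increases the distance spectral
    radius.  Let G have edge connectivity r.  If some vertex has degree r, then
    G is a spanning subgraph of K(n-1,r) and monotonicity concludes.  Otherwise
    all degrees exceed r, so both sides S, T of a minimum edge cut have at least
    r + 2 vertices.  All but r of the pairs in S x T are at distance at least 2,
    so the average row sum gives n rho(G) >= n(n-1) + 2(|S||T| - r), which is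
    larger than n^2 + 2n - 4, whereas n rho(K(n-1,r)) <= n^2 + 2n - 4. *)

Set Implicit Arguments.
Unset Strict Implicit.
Unset Printing Implicit Defensive.

Import Order.TTheory GRing.Theory Num.Theory.

(** * Quadratic forms of real matrices and positive semidefiniteness *)

Section QuadraticForm.
Local Open Scope ring_scope.
Variables (R : realType) (n : nat).
Implicit Types (A B : 'M[R]_n) (x y : 'rV[R]_n) (c : R).

Definition bil B x y : R := (x *m B *m y^T) 0 0.

Definition psd B := forall x, 0 <= bil B x x.

Lemma bilE B x y : bil B x y = \sum_i \sum_j x 0 i * B i j * y 0 j.
Proof.
rewrite /bil mxE exchange_big /=; apply: eq_bigr => j _.
by rewrite !mxE mulr_suml.
Qed.

Lemma bil_symm B x y : B^T = B -> bil B x y = bil B y x.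
Proof.
move=> symB; rewrite !bilE exchange_big /=.
apply: eq_bigr => i _; apply: eq_bigr => j _.
by rewrite -[in LHS]symB mxE; ring.
Qed.

Lemma bil_comb B c d x y : B^T = B ->
  bil B (c *: x + d *: y) (c *: x + d *: y) =
  c ^+ 2 * bil B x x + c * d * bil B x y *+ 2 + d ^+ 2 * bil B y y.
Proof.
move=> symB; have /esym := bil_symm x y symB.
rewrite /bil linearP /= linearZ /= !mulmxDl !mulmxDr -!scalemxAl -!scalemxAr.
by rewrite !mxE => ->; ring.
Qed.

(** The form is nonnegative on the plane spanned by [x] and [y]; evaluating it at one well-chosen
    combination gives the inequality. *)
Lemma psd_cauchy_schwarz B x y : B^T = B -> psd B ->
  bil B x y ^+ 2 <= bil B x x * bil B y y.
Proof.
move=> symB pB; have qx := pB x; have qy := pB y.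
have q c d : 0 <= c ^+ 2 * bil B x x + c * d * bil B x y *+ 2
                  + d ^+ 2 * bil B y y by rewrite -bil_comb //.
set u := bil B x x in q qx *; set v := bil B y y in q qy *.
set w := bil B x y in q *.
have [v0|v_gt0] := leP v 0.
  have vE : v = 0 by apply/eqP; rewrite eq_le v0.
  (* Here the form takes the value [- w ^+ 2 * (u + 2)] with [u] nonnegative, which forces
     [w = 0]. *)
  have := q w (- u - 1); rewrite vE !mulr0 addr0.
  have : 0 <= w ^+ 2 by exact: sqr_ge0.
  by nra.
(* The vector [v x - w y] is orthogonal to [y] for the form. *)
have := q v (- w).
have -> : v ^+ 2 * u + v * - w * w *+ 2 + (- w) ^+ 2 * v =
          v * (u * v - w ^+ 2) by ring.
by rewrite pmulr_rge0 // subr_ge0.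
Qed.

(** For [y = x B] the value [bil B x y] is the squared norm of [y], and Cauchy-Schwarz makes it
    vanish. *)
Lemma psd_isotropic B x : B^T = B -> psd B -> bil B x x = 0 -> x *m B = 0.
Proof.
move=> symB pB qx0; set y := x *m B.
have xy : bil B x y = \sum_j y 0 j ^+ 2.
  by rewrite /bil mxE; apply: eq_bigr => j _; rewrite [y^T _ _]mxE expr2.
have := psd_cauchy_schwarz x y symB pB; rewrite qx0 mul0r => le0.
have /eqP : \sum_j y 0 j ^+ 2 = 0.
  apply/eqP; by rewrite -xy -sqrf_eq0 eq_le le0 sqr_ge0.
rewrite psumr_eq0 => [/allP h|j _]; last exact: sqr_ge0.
apply/rowP => j; rewrite [RHS]mxE; apply/eqP; rewrite -sqrf_eq0.
exact: h (mem_index_enum j).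
Qed.

Lemma bil1E x y : bil 1%:M x y = \sum_j x 0 j * y 0 j.
Proof. by rewrite /bil mulmx1 mxE; apply: eq_bigr => j _; rewrite mxE. Qed.

Lemma bil_scalar_sub c A x :
  bil (c%:M - A) x x = c * bil 1%:M x x - bil A x x.
Proof. by rewrite /bil mulmxBr mul_mx_scalar mulmx1 mulmxBl -scalemxAl !mxE. Qed.

Lemma norm2_ge0 x : 0 <= bil 1%:M x x.
Proof. by rewrite bil1E sumr_ge0 // => j _; rewrite -expr2 sqr_ge0. Qed.

Lemma norm2_eq0 x : (bil 1%:M x x == 0) = (x == 0).
Proof.
rewrite bil1E psumr_eq0 => [|j _]; last by rewrite -expr2 sqr_ge0.
apply/allP/eqP => [h|-> j _]; last by rewrite /= mxE mulr0 eqxx.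
apply/rowP => j; rewrite mxE; apply/eqP.
by have := h j (mem_index_enum j); rewrite /= mulf_eq0 orbb.
Qed.

(** A crude bound, from [|x_i x_j| <= |x|^2], that suffices wherever some finite constant is
    wanted. *)
Lemma bil_le_norm2 A x :
  bil A x x <= (\sum_i \sum_j `|A i j|) * bil 1%:M x x.
Proof.
rewrite bilE mulr_suml; apply: ler_sum => i _.
rewrite mulr_suml; apply: ler_sum => j _.
have le_coord k : x 0 k ^+ 2 <= bil 1%:M x x.
  rewrite bil1E (bigD1 k) //= -expr2 lerDl sumr_ge0 // => l _.
  by rewrite -expr2 sqr_ge0.
have [hi hj] := (le_coord i, le_coord j).
have xx : `|x 0 i * x 0 j| <= bil 1%:M x x.
  rewrite ler_norml; apply/andP; split; nra.
apply: le_trans (ler_norm _) _.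
by rewrite mulrAC normrM mulrC ler_wpM2l.
Qed.

End QuadraticForm.

(** * The largest eigenvalue of a symmetric matrix and its Perron vector *)

Section TopEigenvalue.
Local Open Scope ring_scope.
Variables (R : realType) (n : nat) (A : 'M[R]_n).
Hypotheses (n_gt0 : (0 < n)%N) (symA : A^T = A).

Let E : set R := [set c | psd (c%:M - A)]%classic.
(** As an infimum it yields the Rayleigh bound directly; that it is an eigenvalue is shown in
    [eigenvalue_top]. *)
Definition top_eigenvalue : R := inf E.

Let symB c : (c%:M - A)^T = c%:M - A.
Proof. by rewrite linearB /= tr_scalar_mx symA. Qed.

Let E_nonempty : (E !=set0)%classic.
Proof.
by exists (\sum_i \sum_j `|A i j|) => x; rewrite bil_scalar_sub subr_ge0 bil_le_norm2.
Qed.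

Let E_lbound : has_lbound E.
Proof.
pose e : 'rV[R]_n := delta_mx 0 (Ordinal n_gt0).
have e_gt0 : 0 < bil 1%:M e e.
  rewrite lt_def norm2_ge0 andbT norm2_eq0; apply/eqP => /rowP /(_ (Ordinal n_gt0)).
  by rewrite !mxE !eqxx /= => /eqP; rewrite oner_eq0.
exists (bil A e e / bil 1%:M e e) => c /(_ e).
by rewrite bil_scalar_sub subr_ge0 ler_pdivrMr.
Qed.

Lemma rayleigh_top x : bil A x x <= top_eigenvalue * bil 1%:M x x.
Proof.
have [->|x_neq0] := eqVneq x 0; first by rewrite /bil !mul0mx mxE mulr0.
have x_gt0 : 0 < bil 1%:M x x by rewrite lt_def norm2_eq0 x_neq0 norm2_ge0.
rewrite -ler_pdivrMr //; apply: lb_le_inf => // c /(_ x).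
by rewrite bil_scalar_sub subr_ge0 ler_pdivrMr.
Qed.

Lemma psd_top : psd (top_eigenvalue%:M - A).
Proof. by move=> x; rewrite bil_scalar_sub subr_ge0 rayleigh_top. Qed.

(* If B = top - A were invertible, Cauchy-Schwarz applied to x and x B^-1     *)
(* would give |x|^2 <= C * bil B x x, so that top - 1/C would still dominate A *)
Lemma eigenvalue_top : eigenvalue A top_eigenvalue.
Proof.
set l := top_eigenvalue; pose B := l%:M - A.
have unitN : B \notin unitmx.
  apply/negP => uB; pose C : R := 1 + \sum_i \sum_j `|(invmx B)^T i j|.
  have C_gt0 : 0 < C.
    by rewrite ltr_pwDl // sumr_ge0 // => i _; rewrite sumr_ge0.
  have lower x : bil 1%:M x x <= C * bil B x x.
    have := psd_cauchy_schwarz (x *m invmx B) x (symB l) psd_top.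
    rewrite -/l -/B.
    have -> : bil B (x *m invmx B) x = bil 1%:M x x by rewrite /bil mulmxKV // mulmx1.
    have -> : bil B (x *m invmx B) (x *m invmx B) = bil (invmx B)^T x x.
      by rewrite /bil mulmxKV // trmx_mul mulmxA.
    have ub : bil (invmx B)^T x x <= C * bil 1%:M x x.
      apply: le_trans (bil_le_norm2 _ _) _.
      by rewrite ler_wpM2r ?norm2_ge0 // lerDr.
    have [->|x_neq0] := eqVneq x 0; first by move=> _; rewrite /bil !mul0mx mxE mulr0.
    have x_gt0 : 0 < bil 1%:M x x by rewrite lt_def norm2_eq0 x_neq0 norm2_ge0.
    have qx : 0 <= bil B x x by exact: psd_top.
    move=> cs; rewrite -(ler_pM2l x_gt0) -expr2; apply: le_trans cs _.
    by rewrite mulrA [_ * C]mulrC ler_wpM2r.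
  have : l - C^-1 \in E.
    rewrite inE => x; rewrite bil_scalar_sub mulrBl.
    have := lower x; rewrite bil_scalar_sub -/l -ler_pdivrMl //.
    by rewrite mulrC; lra.
  rewrite inE => /(ge_inf E_lbound); rewrite -/top_eigenvalue -/l.
  by have : 0 < C^-1 by [rewrite invr_gt0]; lra.
rewrite /eigenvalue /eigenspace kermx_eq0 row_free_unit.
by rewrite -opprB -scaleN1r unitmxZ ?unitrN1.
Qed.

Lemma sup_eigenvalue : sup [set a : R | eigenvalue A a]%classic = top_eigenvalue.
Proof.
have ub : ubound [set a : R | eigenvalue A a]%classic top_eigenvalue.
  move=> a /= /eigenvalueP[x xA x_neq0].
  have x_gt0 : 0 < bil 1%:M x x by rewrite lt_def norm2_eq0 x_neq0 norm2_ge0.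
  have := rayleigh_top x.
  by rewrite {1}/bil xA -scalemxAl mxE -{1}[x]mulmx1 -/(bil _ _ _) ler_pM2r.
apply/le_anti/andP; split.
  by apply: ge_sup => //; exists top_eigenvalue; exact: eigenvalue_top.
by apply: ub_le_sup; [exists top_eigenvalue | exact: eigenvalue_top].
Qed.

(** Taking absolute values of the entries of a top eigenvector keeps the norm and does not lower the
    form of [A]. The new vector is therefore isotropic for [top_eigenvalue - A], hence again an
    eigenvector. *)
Lemma perron_vector : (forall i j, 0 <= A i j) ->
    (forall i j, i != j -> 0 < A i j) ->
  exists2 x : 'rV[R]_n, (forall i, 0 < x 0 i) & x *m A = top_eigenvalue *: x.
Proof.
move=> A_ge0 A_gt0; have /eigenvalueP[x xA x_neq0] := eigenvalue_top.
pose y : 'rV[R]_n := \row_i `|x 0 i|.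
have yy : bil 1%:M y y = bil 1%:M x x.
  rewrite !bil1E; apply: eq_bigr => j _.
  by rewrite !mxE -!expr2 real_normK ?num_real.
have xAx : bil A x x = top_eigenvalue * bil 1%:M x x.
  by rewrite /bil xA -scalemxAl mulmx1 mxE.
have yAy : bil A x x <= bil A y y.
  rewrite !bilE; apply: ler_sum => i _; apply: ler_sum => j _.
  rewrite !mxE; apply: le_trans (ler_norm _) _.
  by rewrite !normrM (ger0_norm (A_ge0 _ _)).
have yA : y *m A = top_eigenvalue *: y.
  apply/esym/eqP; rewrite -subr_eq0 -mul_mx_scalar -mulmxBr; apply/eqP.
  apply: psd_isotropic => //; first exact: psd_top.
  apply/eqP; rewrite eq_le psd_top andbT bil_scalar_sub yy -xAx.
  by rewrite subr_le0.
exists y => // i; rewrite mxE lt_def normr_ge0 andbT; apply/negP => xi0.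
move/negP: x_neq0; apply; apply/eqP/rowP => j; rewrite mxE; apply/eqP.
have [->|ji] := eqVneq j i; first by rewrite -normr_eq0.
(* If entry [i] of [y] vanishes, coordinate [i] of the eigenvalue equation is a zero sum of
   nonnegative terms [y_j A_ji], so every other entry vanishes too. *)
have /rowP /(_ i) := yA; rewrite !mxE (eqP xi0) mulr0 => /eqP.
rewrite psumr_eq0 => [/allP /(_ j (mem_index_enum j))|k _]; last first.
  by rewrite mxE mulr_ge0.
by rewrite /= mxE mulf_eq0 normr_eq0 [A j i == 0]gt_eqF ?A_gt0 // orbF.
Qed.

End TopEigenvalue.

(** * Distances in a graph *)

Section Distance.
Variable G : sgraph.
Implicit Types (x y : G) (s : seq G).

Lemma dist_le_size x y s : upath x y s -> dist x y <= size s.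
Proof.
move=> us; rewrite leqNgt; apply/negP => lt_s.
have ltG : size s < #|vertex G|.
  by case/and3P: us => _ _ /card_uniqP /= <-; exact: max_card.
have := before_find 0 lt_s; rewrite nth_iota // add0n => /negbT/existsP; apply.
by exists (in_tuple s).
Qed.

Lemma dist_le_card x y : dist x y <= #|vertex G|.
Proof. by apply: leq_trans (find_size _ _) _; rewrite size_iota. Qed.

Lemma dist_upath x y : dist x y < #|vertex G| ->
  exists2 s, upath x y s & size s = dist x y.
Proof.
move=> ltG; have hasP : has (fun k => [exists s : k.-tuple G, upath x y s])
    (iota 0 #|vertex G|) by rewrite has_find size_iota.
have /existsP[t ut] := nth_find 0 hasP; exists t => //.
by rewrite size_tuple nth_iota.
Qed.

Lemma dist_le_rev x y : dist x y <= dist y x.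
Proof.
have [/dist_upath[s us <-]|geG] := ltnP (dist y x) #|vertex G|; last first.
  exact: leq_trans (dist_le_card _ _) geG.
case/and3P: us => ps /eqP ls us.
have -> : size s = size (rev (belast y s)) by rewrite size_rev size_belast.
apply: dist_le_size; apply/and3P; split.
- rewrite -ls rev_path; rewrite (@eq_path _ _ (@adj G)) // => u v.
  exact: adj_sym.
- by case: s ls {ps us} => [<- //|z s _]; rewrite /= rev_cons last_rcons.
- have -> : x :: rev (belast y s) = rev (y :: s).
    by rewrite [y :: s]lastI rev_rcons ls.
  by rewrite rev_uniq.
Qed.

Lemma dist_sym x y : dist x y = dist y x.
Proof. by apply/eqP; rewrite eqn_leq !dist_le_rev. Qed.

Lemma dist_xx x : dist x x = 0.
Proof.
by apply/eqP; rewrite -leqn0 (@dist_le_size x x [::]) // /upath /= eqxx.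
Qed.

Lemma dist_adj x y : adj x y -> dist x y <= 1.
Proof.
move=> xy; apply: (@dist_le_size x y [:: y]).
rewrite /upath /= xy eqxx inE /= andbT; apply: contraTneq xy => ->.
by rewrite adj_irr.
Qed.

Lemma dist_two x z y : adj x z -> adj z y -> x != y -> dist x y <= 2.
Proof.
move=> xz zy xy; apply: (@dist_le_size x y [:: z; y]).
rewrite /upath /= xz zy eqxx !inE negb_or xy /= !andbT.
apply/andP; split; [move: xz|move: zy]; apply: contraTneq => ->;
  by rewrite adj_irr.
Qed.

(** Adjacent and nonadjacent pairs share one formula so that [transmission_ge] can compare sums term
    by term. *)
Lemma dist_gt x y : x != y -> (~~ adj x y).+1 <= dist x y.
Proof.
move=> xy; have G_gt1 : 1 < #|vertex G| by apply/card_gt1P; exists x, y.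
have [le1|//] := leqP (dist x y) 1; last by apply: leq_trans; case: adj.
have [s /and3P[]] := dist_upath (leq_ltn_trans le1 G_gt1).
case: s => [|z [|w s]] /=; first by rewrite (negPf xy).
  by rewrite andbT => xz /eqP zy _ <-; rewrite -zy xz.
by move=> _ _ _ sE; rewrite -sE in le1.
Qed.

(** Recovers the graph from its distances in the equality case of [rho_spanning]. *)
Lemma adj_dist x y : adj x y = (dist x y == 1).
Proof.
apply/idP/eqP => [xy|d1].
  apply/eqP; rewrite eqn_leq dist_adj //=.
  have /dist_gt : x != y by apply: contraTneq xy => ->; rewrite adj_irr.
  by rewrite xy.
have xy : x != y by apply: contra_eq_neq d1 => ->; rewrite dist_xx.
by have := dist_gt xy; rewrite d1; case: adj.
Qed.

End Distance.

(** Paths map to paths of the same length. The cardinality hypothesis covers pairs with no path,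
    whose distance is the default [#|vertex G|]. *)
Lemma dist_homo (G H : sgraph) (g : G -> H) :
    injective g -> (forall x y, adj x y -> adj (g x) (g y)) ->
    #|vertex H| <= #|vertex G| ->
  forall x y, dist (g x) (g y) <= dist x y.
Proof.
move=> g_inj g_adj leHG x y.
have [/dist_upath[s us <-]|geG] := ltnP (dist x y) #|vertex G|; last first.
  exact: leq_trans (dist_le_card _ _) (leq_trans leHG geG).
case/and3P: us => ps /eqP ls us.
rewrite -(size_map g); apply: dist_le_size; apply/and3P; split.
- by rewrite path_map; apply: sub_path ps => u v; exact: g_adj.
- by rewrite last_map ls.
- by rewrite -map_cons map_inj_uniq.
Qed.

(** * The distance spectral radius: Rayleigh and Collatz-Wielandt bounds, monotonicity *)

Section SpectralRadius.
Local Open Scope ring_scope.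
Variable R : realType.
Local Notation rho := (dist_spectral_radius R).

Section OneGraph.
Variable G : sgraph.
Hypothesis G_gt0 : (0 < #|vertex G|)%N.

Let sum_vertex (F : G -> R) : \sum_u F u =
  \sum_(i < #|vertex G|) F (enum_val i).
Proof. exact: reindex (onW_bij _ (enum_val_bij (vertex G))). Qed.

Let dist_mx_sym : (dist_mx R G)^T = dist_mx R G.
Proof. by apply/matrixP => i j; rewrite !mxE dist_sym. Qed.

Let rhoE : rho G = top_eigenvalue (dist_mx R G).
Proof. exact: sup_eigenvalue. Qed.

Lemma dist_rayleigh (x : G -> R) :
  \sum_u \sum_v x u * (dist u v)%:R * x v <= rho G * \sum_u x u ^+ 2.
Proof.
rewrite rhoE; have := rayleigh_top (dist_mx R G) (\row_i x (enum_val i)).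
rewrite bilE bil1E !sum_vertex.
under eq_bigr do under eq_bigr do rewrite !mxE.
under [X in _ * X]eq_bigr do rewrite !mxE -expr2.
by under [X in _ -> X <= _]eq_bigr do rewrite sum_vertex.
Qed.

Lemma dist_perron : exists2 x : G -> R, (forall u, 0 < x u) &
  forall v, \sum_u x u * (dist u v)%:R = rho G * x v.
Proof.
rewrite rhoE; case: (perron_vector G_gt0 dist_mx_sym) => [i j|i j ij|x x_gt0 xA].
- by rewrite mxE.
- rewrite mxE ltr0n; apply: leq_trans (dist_gt _) => //.
  by rewrite (inj_eq enum_val_inj).
exists (fun u => x 0 (enum_rank u)) => // v.
have /rowP /(_ (enum_rank v)) := xA; rewrite !mxE => <-.
rewrite sum_vertex; apply: eq_bigr => i _.
by rewrite mxE enum_rankK enum_valK.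
Qed.

(** Rayleigh quotient of the all-ones vector. *)
Lemma rho_ge_transmission :
  (\sum_(u : G) \sum_(v : G) dist u v)%:R <= rho G * #|vertex G|%:R.
Proof.
have := dist_rayleigh (fun=> 1).
under [X in _ * X]eq_bigr do rewrite expr1n.
rewrite sumr_const natr_sum; apply: le_trans; apply: ler_sum => u _.
by rewrite natr_sum; apply: ler_sum => v _; rewrite mul1r mulr1.
Qed.

(** Pairing the row inequalities with the Perron vector [x] gives [rho G * <x, y> <= c * <x, y>],
    and [<x, y>] is positive. The matrix [d] only has to dominate the distances. *)
Lemma rho_le_collatz (c : R) (d : G -> G -> R) (y : G -> R) :
    (forall u, 0 < y u) -> (forall u v, (dist u v)%:R <= d u v) ->
    (forall u, \sum_v d u v * y v <= c * y u) ->
  rho G <= c.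
Proof.
move=> y_gt0 le_d le_c; have [x x_gt0 xA] := dist_perron.
have xy_gt0 : 0 < \sum_u x u * y u.
  have /card_gt0P[u0 _] := G_gt0.
  rewrite (bigD1 u0) //= ltr_pwDl ?mulr_gt0 // sumr_ge0 // => u _.
  by rewrite ltW ?mulr_gt0.
rewrite -(ler_pM2r xy_gt0) !mulr_sumr.
under eq_bigr do rewrite mulrA -xA mulr_suml.
rewrite exchange_big /=; apply: ler_sum => u _.
rewrite mulrCA; apply: (@le_trans _ _ (x u * \sum_v d u v * y v)).
  rewrite mulr_sumr; apply: ler_sum => v _.
  by rewrite -mulrA ler_pM2l // ler_pM2r.
by rewrite ler_pM2l.
Qed.

End OneGraph.

(** The Perron vector of [H], transported along [f], is a trial vector for [G]. In case of equality
    the nonnegative terms [gap u v] sum to at most zero, and positivity of the vector makes the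
    distances agree. *)
Lemma rho_le_bij (H G : sgraph) (f : H -> G) : (0 < #|vertex H|)%N ->
    bijective f -> (forall u v, dist u v <= dist (f u) (f v))%N ->
  rho H <= rho G /\
  (rho G = rho H -> forall u v, dist u v = dist (f u) (f v)).
Proof.
move=> H_gt0 f_bij le_f; have [g fK gK] := f_bij.
have G_gt0 : (0 < #|vertex G|)%N by rewrite -(bij_eq_card f_bij).
have [x x_gt0 xA] := dist_perron H_gt0.
have xx_gt0 : 0 < \sum_u x u ^+ 2.
  have /card_gt0P[u0 _] := H_gt0.
  rewrite (bigD1 u0) //= ltr_pwDl ?exprn_gt0 // sumr_ge0 // => u _.
  by rewrite sqr_ge0.
pose gap u v := x u * ((dist (f u) (f v))%:R - (dist u v)%:R) * x v.
have gap_ge0 u v : 0 <= gap u v.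
  apply: mulr_ge0; last exact: ltW.
  by apply: mulr_ge0; [exact: ltW | rewrite subr_ge0 ler_nat].
have gapE : \sum_v \sum_u gap u v <= (rho G - rho H) * \sum_u x u ^+ 2.
  have := dist_rayleigh G_gt0 (x \o g).
  rewrite !(reindex f (onW_bij _ f_bij)) /=.
  under [X in _ * X]eq_bigr do rewrite fK.
  under eq_bigr do rewrite (reindex f (onW_bij _ f_bij)) /=.
  under eq_bigr do under eq_bigr do rewrite !fK.
  have -> : \sum_v \sum_u gap u v =
      \sum_u \sum_v x u * (dist (f u) (f v))%:R * x v - rho H * \sum_u x u ^+ 2.
    rewrite [X in X - _]exchange_big mulr_sumr /= -sumrB; apply: eq_bigr => v _.
    rewrite expr2 mulrA -xA mulr_suml -sumrB; apply: eq_bigr => u _.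
    by rewrite /gap; ring.
  by move=> h; rewrite mulrBl lerD2r.
split=> [|eq_rho u v].
  rewrite -subr_ge0 -(pmulr_lge0 _ xx_gt0); apply: le_trans gapE.
  by apply: sumr_ge0 => v _; apply: sumr_ge0.
have gap0 : gap u v <= 0.
  apply: le_trans (_ : \sum_v \sum_u gap u v <= 0); last first.
    by rewrite eq_rho subrr mul0r in gapE.
  rewrite (bigD1 v) //= (bigD1 u) //= -addrA lerDl addr_ge0 ?sumr_ge0 //.
  by move=> w _; rewrite sumr_ge0.
apply/eqP; rewrite eqn_leq le_f /= -(ler_nat R) -subr_le0.
by move: gap0; rewrite /gap pmulr_lle0 // pmulr_rle0.
Qed.

End SpectralRadius.

Section SpectralRadiusIso.
Variable R : realType.
Local Notation rho := (dist_spectral_radius R).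

(** The inverse of [f] embeds [G] as a spanning subgraph of [H], so distances in [G] are at least
    those in [H]. *)
Lemma rho_spanning (H G : sgraph) (f : H -> G) : 1 < #|vertex H| ->
    bijective f -> (forall u v, adj (f u) (f v) -> adj u v) ->
  (rho H <= rho G)%R /\ (rho G = rho H -> graph_iso G H).
Proof.
move=> H_gt1 f_bij f_adj; have [g fK gK] := f_bij.
have cardE : #|vertex H| = #|vertex G| := bij_eq_card f_bij.
have le_f u v : dist u v <= dist (f u) (f v).
  rewrite -{1}[u]fK -{1}[v]fK; apply: dist_homo; first exact: can_inj gK.
    by move=> x y xy; apply: f_adj; rewrite !gK.
  by rewrite cardE.
have [le_rho eq_rho] := rho_le_bij R (ltnW H_gt1) f_bij le_f.
split=> // /eq_rho eq_dist; exists g; split; first by exists f.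
by move=> x y; rewrite !adj_dist eq_dist !gK.
Qed.

Lemma rho_iso (G H : sgraph) : 1 < #|vertex G| -> graph_iso G H -> rho G = rho H.
Proof.
move=> G_gt1 [f [f_bij f_adj]]; have [g fK gK] := f_bij.
apply/le_anti/andP; split.
  by apply: (proj1 (rho_spanning G_gt1 f_bij _)) => u v; rewrite f_adj.
have g_bij : bijective g by exists f.
apply: (proj1 (rho_spanning _ g_bij _)) => [|u v].
  by rewrite -(bij_eq_card f_bij).
by rewrite -f_adj !gK.
Qed.

End SpectralRadiusIso.

Lemma card_rel_sum (T : finType) (e : rel T) :
  #|[set p : T * T | e p.1 p.2]| = \sum_x \sum_y (e x y : nat).
Proof.
rewrite -sum1_card big_mkcond (pair_bigA _ (fun x y => (e x y : nat))) /=.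
by apply: eq_bigr => p _; rewrite inE; case: (e _ _).
Qed.

(** * Edge cuts, edge connectivity and the sum of all distances *)

Section Cuts.
Variable G : sgraph.
Implicit Types (S : {set G}) (F : {set {set G}}).

(** Crossing edges are kept as pairs oriented out of [S]: each edge occurs once, and cardinals
    become double sums. *)
Definition cut S : {set G * G} :=
  [set p | [&& p.1 \in S, p.2 \notin S & adj p.1 p.2]].

Lemma card_cut_edges S :
  #|[set [set p.1; p.2] | p in cut S]| = #|cut S|.
Proof.
apply: card_in_imset => -[a b] [c d]; rewrite !inE /=.
case/and3P=> aS bS _ /and3P[cS dS _] eq_ab.
have : a \in [set c; d] by rewrite -eq_ab set21.
have : b \in [set c; d] by rewrite -eq_ab set22.
rewrite !inE => /orP[/eqP bE|/eqP ->]; first by rewrite bE cS in bS.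
by case/orP=> [/eqP ->//|/eqP aE]; rewrite -aE aS in dS.
Qed.

(** A walk that starts in [S] and avoids [F] never leaves [S]. *)
Lemma disconnecting_cut F S x y : F \subset edges G -> x \in S -> y \notin S ->
  (forall p, p \in cut S -> [set p.1; p.2] \in F) -> disconnecting F.
Proof.
move=> sFE xS yS cutF; rewrite /disconnecting sFE /=.
apply/negP => /forallP/(_ x)/forallP/(_ y)/connectP[s].
elim: s x xS => [|z s IHs] x xS /=; first by move=> _ yE; rewrite yE xS in yS.
case/andP=> /andP[xz xzF] pzs; apply: (IHs z) => //.
by apply: contraNT xzF => zS; apply: (cutF (x, z)); rewrite inE /= xS zS.
Qed.

(** Validates the default of the arg min, as [arg_minnP] requires. *)
Lemma disconnecting_edges : 1 < #|vertex G| -> disconnecting (edges G).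
Proof.
case/card_gt1P=> x [y [_ _ xy]].
apply: (@disconnecting_cut _ [set x] x y); rewrite ?set11 //.
  by rewrite inE eq_sym.
by case=> u v; rewrite inE => /and3P[_ _ uv]; apply/imsetP; exists (u, v); rewrite ?inE.
Qed.

Lemma edge_connectivity_le_cut S x y : x \in S -> y \notin S ->
  edge_connectivity G <= #|cut S|.
Proof.
move=> xS yS.
have G_gt1 : 1 < #|vertex G|.
  by apply/card_gt1P; exists x, y; split=> //; apply: contraNneq yS => <-.
rewrite /edge_connectivity; case: arg_minnP => [|F _ minF].
  exact: disconnecting_edges.
rewrite -card_cut_edges; apply: minF; apply: (disconnecting_cut _ xS yS) => [|p pS].
  apply/fintype.subsetP => e /imsetP[p]; rewrite inE => /and3P[_ _ adj_p] ->.
  by apply/imsetP; exists p; rewrite ?inE.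
exact: imset_f.
Qed.

(** Take for [S] a component left after deleting a minimum disconnecting set [F]; every edge leaving
    [S] lies in [F]. *)
Lemma edge_connectivity_cut : 1 < #|vertex G| ->
  exists S, [/\ exists x, x \in S, exists y, y \notin S &
               #|cut S| <= edge_connectivity G].
Proof.
move=> G_gt1; rewrite /edge_connectivity; case: arg_minnP => [|F].
  exact: disconnecting_edges.
case/andP=> _ /forallPn[x /forallPn[y xy]] _.
exists [set z | connect (del_edges F) x z]; split.
- by exists x; rewrite inE connect0.
- by exists y; rewrite inE.
rewrite -card_cut_edges; apply/subset_leq_card/fintype.subsetP => e /imsetP[[u v]].
rewrite !inE /= => /and3P[xu xv uv] ->; apply: contraNT xv => uvF.
by apply: connect_trans xu (connect1 _); rewrite /del_edges uv.
Qed.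

Lemma card_cut S : #|cut S| = \sum_(u in S) \sum_(v in ~: S) adj u v.
Proof.
rewrite (card_rel_sum (fun u v => [&& u \in S, v \notin S & adj u v])).
rewrite [RHS]big_mkcond; apply: eq_bigr => u _; case: ifP => // _; last first.
  by rewrite big1.
by rewrite [RHS]big_mkcond; apply: eq_bigr => v _; rewrite inE; case: (v \in S).
Qed.

Lemma card_cutC S : #|cut (~: S)| = #|cut S|.
Proof.
rewrite !card_cut finset.setCK exchange_big /=; apply: eq_bigr => u _.
by apply: eq_bigr => v _; rewrite adj_sym.
Qed.

Lemma card_cut1 u : #|cut [set u]| = #|[set v | adj u v]|.
Proof.
rewrite card_cut big_set1 -sum1_card big_mkcond [RHS]big_mkcond.
apply: eq_bigr => v _; rewrite !inE; have [->|_] := eqVneq v u => /=.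
  by rewrite adj_irr.
by case: adj.
Qed.

(** Each vertex of [S] has at least [r + 1] neighbours, of which at most [#|S| - 1] lie in [S]; the
    others account for edges of the cut. *)
Lemma card_side_of_small_cut r S : (forall u, r < #|cut [set u]|) ->
  (exists x, x \in S) -> #|cut S| <= r -> r.+2 <= #|S|.
Proof.
move=> deg /card_gt0P S_gt0 le_r.
have : \sum_(u in S) r.+1 <= \sum_(u in S) (#|S|.-1 + \sum_(v in ~: S) adj u v).
  apply: leq_sum => u uS; apply: leq_trans (deg u) _.
  rewrite card_cut1 -sum1_card (bigID (mem S)) /=; apply: leq_add.
    rewrite sum1_card (cardsD1 u S) uS /=; apply/subset_leq_card/fintype.subsetP => v.
    rewrite !inE => /andP[uv ->]; rewrite andbT.
    by apply: contraTneq uv => ->; rewrite inE adj_irr.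
  rewrite big_mkcond [X in _ <= X]big_mkcond; apply: leq_sum => v _.
  by rewrite !inE; case: (v \in S); case: adj.
(* With [s = #|S|] the sum reads [s * (r + 2 - s) <= r], whereas the left side is at least [r + 1]
   for [1 <= s <= r + 1]. *)
rewrite big_split /= -card_cut !sum_nat_const; nia.
Qed.

(** Distinct vertices contribute at least 1, and one more if [S] separates them and they are not
    adjacent. The cut stands on the right to avoid truncated subtraction. *)
Lemma transmission_ge S :
  #|vertex G| * #|vertex G|.-1 + 2 * (#|S| * #|~: S|)
    <= \sum_(u : G) \sum_v dist u v + 2 * #|cut S|.
Proof.
have pairs (A : {set G}) : #|A| * #|~: A| =
    \sum_u \sum_v ((u \in A) && (v \notin A) : nat).
  rewrite -cardsX -(card_rel_sum (fun u v => (u \in A) && (v \notin A))).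
  by apply: eq_card => -[u v]; rewrite !inE.
have offdiag : #|vertex G| * #|vertex G|.-1 = \sum_(u : G) \sum_v (u != v : nat).
  rewrite -sum_nat_const; apply: eq_bigr => u _.
  rewrite -(cardC1 u) -sum1_card big_mkcond; apply: eq_bigr => v _.
  by rewrite !inE eq_sym; case: eqP.
have pairsC : #|S| * #|~: S| =
    \sum_u \sum_v ((u \in ~: S) && (v \notin ~: S) : nat).
  by rewrite -pairs finset.setCK mulnC.
have cutE A : #|cut A| =
    \sum_u \sum_v ([&& u \in A, v \notin A & adj u v] : nat) by exact: card_rel_sum.
(* Each doubled term splits into a count for [S] and one for its complement, covering both orders of
   a pair. *)
rewrite !mul2n -!addnn {1}pairs pairsC -{2}card_cutC !cutE offdiag.
rewrite -!big_split /=; apply: leq_sum => u _.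
rewrite -!big_split /=; apply: leq_sum => v _.
rewrite !inE !negbK; have [->|uv] := eqVneq u v.
  by case: (v \in S); rewrite ?adj_irr.
have := dist_gt uv; case: (adj u v); case: (u \in S); case: (v \in S) => //=;
  by rewrite /= ?addn0 ?add0n; lia.
Qed.

End Cuts.

(** * An upper bound for the distance spectral radius of the extremal graph *)

Section KgraphRadius.
Local Open Scope ring_scope.
Variable R : realType.

Lemma sum_option (T : finType) (F : option T -> R) :
  \sum_w F w = F None + \sum_i F (Some i).
Proof.
rewrite (bigD1 None) //= (reindex_omap Some id) /=; last by case.
by congr (_ + _); apply: eq_bigl => i; rewrite eqxx.
Qed.

Lemma sum_ord_threshold (r m : nat) (a b : R) :
  \sum_(i < r + m) (if (i < r)%N then a else b) = r%:R * a + m%:R * b.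
Proof.
rewrite big_split_ord /=; congr (_ + _).
  rewrite (eq_bigr (fun=> a)) => [|i _]; last by rewrite ltn_ord.
  by rewrite sumr_const card_ord mulr_natl.
rewrite (eq_bigr (fun=> b)) => [|i _]; last by rewrite ltnNge leq_addr.
by rewrite sumr_const card_ord mulr_natl.
Qed.

(* Collatz-Wielandt bound for the test vector worth 2 at the extra vertex,    *)
(* 1 on its neighbours and 1 + 2 / mu elsewhere, with mu = c + 1.             *)
Lemma rho_Kgraph_le (r m : nat) : (0 < r)%N -> (0 < m)%N ->
  dist_spectral_radius R (Kgraph (r + m) r)
    <= (r + m).+1%:R + 2 - 4 / (r + m).+1%:R.
Proof.
move=> r_gt0 m_gt0; set N : R := (r + m).+1%:R.
have NE : N = r%:R + m%:R + 1 by rewrite /N -natr1 natrD.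
have r_ge1 : 1 <= r%:R :> R by rewrite ler1n.
have m_ge1 : 1 <= m%:R :> R by rewrite ler1n.
have N_gt0 : 0 < N by rewrite ltr0n.
set h := N^-1; have hN : h * N = 1 by rewrite mulVf // gt_eqF.
have h_gt0 : 0 < h by rewrite invr_gt0.
have h_le : 3 * h <= 1.
  have : h * 3 <= h * N by rewrite ler_pM2l //; lra.
  by rewrite hN mulrC.
clearbody h N; set c := N + 2 - 4 * h.
have c_gt0 : 0 < c + 1 by rewrite /c; lra.
pose k := 2 / (c + 1).
have kc : k * (c + 1) = 2 by rewrite /k mulfVK // gt_eqF.
have k_gt0 : 0 < k by rewrite divr_gt0.
(* Since [k * (c + 1) = 2], the row inequalities at both kinds of clique vertices reduce to this
   one, which also implies the row of the extra vertex. *)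
have key : r%:R + m%:R + 2 + m%:R * k <= c + 1.
  suff : m%:R * k <= 2 - 4 * h by rewrite /c; lra.
  rewrite mulrA ler_pdivrMr // /c.
  have -> : (2 - 4 * h) * (N + 2 - 4 * h + 1) =
      2 * N + 6 - 20 * h + 16 * h ^+ 2 - 4 * (h * N) by ring.
  by rewrite hN; nra.
pose y (u : option 'I_(r + m)) : R :=
  if u is Some i then (if (i < r)%N then 1 else 1 + k) else 2.
pose d (u v : option 'I_(r + m)) : R :=
  if u == v then 0 else if Kadj r u v then 1 else 2.
have sum_clique (i : 'I_(r + m)) :
    \sum_j d (Some i) (Some j) * y (Some j) =
    r%:R * 1 + m%:R * (1 + k) - y (Some i).
  rewrite -sum_ord_threshold (bigD1 i) //= [in RHS](bigD1 i) //=.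
  rewrite {1}/d eqxx mul0r add0r addrC addrK; apply: eq_bigr => j ji.
  by rewrite /d /= (inj_eq Some_inj) eq_sym (negPf ji) mul1r.
apply: (@rho_le_collatz R (Kgraph (r + m) r) _ c d y) => [|u|u v|u].
- by rewrite card_option card_ord.
- by case: u => [i|] /=; [case: ifP; lra | lra].
- rewrite /d; case: eqVneq => [->|uv]; first by rewrite dist_xx.
  case: ifP => [uvK|]; first by rewrite (ler_nat R _ 1) dist_adj.
  (* A nonadjacent pair contains the extra vertex; clique vertex 0 is a common neighbour because
     [0 < r]. *)
  pose z : 'I_(r + m) := lshift m (Ordinal r_gt0).
  have zP (i : 'I_(r + m)) : (i < r)%N = false -> i != z.
    by apply: contraFneq => ->.
  move=> uvK; rewrite (ler_nat R _ 2); apply: (@dist_two _ u (Some z)) => //.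
    case: u v uv uvK => [i|] [j|] //= uv; last by move/zP.
    by rewrite (inj_eq Some_inj) in uv; rewrite uv.
  case: u v uv uvK => [i|] [j|] //= uv; last by move/zP; rewrite eq_sym.
  by rewrite (inj_eq Some_inj) in uv; rewrite uv.
rewrite sum_option; case: u => [i|]; last first.
  rewrite {1}/d eqxx mul0r add0r.
  rewrite (eq_bigr (fun i : 'I__ => if (i < r)%N then 1 else 2 * (1 + k))).
    by rewrite sum_ord_threshold /y; nra.
  by move=> i _; rewrite /d /=; case: ifP => _; rewrite ?mul1r.
rewrite sum_clique /d /=; case: ifP => _; nra.
Qed.

End KgraphRadius.

(** * Connectedness and edge connectivity of the extremal graph *)

Section KgraphConnectivity.
Variables (p r : nat).
Hypotheses (r_gt0 : 0 < r) (r_lt : r < p).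
Local Notation K := (Kgraph p r).

Lemma Kgraph_connected : connected K.
Proof.
pose z : K := Some (Ordinal (ltn_trans r_gt0 r_lt)).
have to_z (x : K) : connect (@adj K) x z /\ connect (@adj K) z x.
  have [->|xz] := eqVneq x z; first by rewrite connect0.
  have xzK : adj x z by case: x xz => [i|] //=; rewrite (inj_eq Some_inj).
  by split; apply: connect1; rewrite // adj_sym.
apply/forallP => x; apply/forallP => y.
exact: connect_trans (to_z x).1 (to_z y).2.
Qed.

(* Besides the r edges at the extra vertex, a clique vertex i in S and a      *)
(* clique vertex j outside S give p - 1 crossing edges, one for each k <> i.  *)
Lemma Kgraph_cut_ge (S : {set K}) (x y : K) :
  x \in S -> y \notin S -> None \notin S -> r <= #|cut S|.
Proof.
move=> xS yS nS; case: x xS => [i|] xS; last by rewrite xS in nS.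
case: (pickP [pred j : 'I_p | (Some j : K) \notin S]) => [j /= jS|allS].
  pose f (k : 'I_p) : K * K :=
    if (Some k : K) \in S then (Some k, Some j) else (Some i, Some k).
  have f_inj : {in [set~ i] &, injective f}.
    move=> k l; rewrite !inE => ki li; rewrite /f.
    by case: ifP => kS; case: ifP => lS [] // *; subst; rewrite ?eqxx in ki li *.
  have card_f : #|f @: [set~ i]| = p.-1 by rewrite (card_in_imset f_inj) cardsC1 card_ord.
  apply: leq_trans (_ : p.-1 <= _); first by case: p r_lt.
  rewrite -card_f; apply/subset_leq_card/fintype.subsetP => e /imsetP[k].
  rewrite !inE /f => ki ->; case: ifP => kS /=.
    by rewrite kS jS /=; apply: contraNneq jS => <-.
  by rewrite xS kS /= eq_sym.
pose f (k : 'I_r) : K * K := (Some (widen_ord (ltnW r_lt) k), None).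
have f_inj : injective f by move=> k l [/val_inj].
rewrite -{1}[r]card_ord -(card_imset _ f_inj).
apply/subset_leq_card/fintype.subsetP => e /imsetP[k _ ->].
by rewrite inE /= nS ltn_ord (negbFE (allS _)).
Qed.

Lemma Kgraph_edge_connectivity : edge_connectivity K = r.
Proof.
apply/eqP; rewrite eqn_leq; apply/andP; split.
  pose z : K := Some (Ordinal (ltn_trans r_gt0 r_lt)).
  have := @edge_connectivity_le_cut K [set None] None z.
  rewrite !inE => /(_ isT isT)/leq_trans; apply.
  pose f (k : 'I_r) : K * K := (None, Some (widen_ord (ltnW r_lt) k)).
  rewrite -[X in _ <= X]card_ord -cardsT; apply: leq_trans (leq_imset_card f _).
  apply/subset_leq_card/fintype.subsetP => -[u v]; rewrite !inE /=.
  case/and3P=> /eqP -> _; case: v => //= j jr.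
  by apply/imsetP; exists (Ordinal jr) => //; congr (_, Some _); apply: val_inj.
have K_gt1 : 1 < #|vertex K|.
  by rewrite card_option card_ord ltnS (ltn_trans r_gt0).
have [S [[x xS] [y yS]] /(leq_trans _)] := edge_connectivity_cut K_gt1; apply.
(* A set and its complement have cuts of equal size, and one of them misses the extra vertex. *)
have [nS|nS] := boolP ((None : K) \in S); last exact: Kgraph_cut_ge xS yS nS.
by rewrite -card_cutC; apply: (@Kgraph_cut_ge _ y x); rewrite ?inE ?negbK.
Qed.

End KgraphConnectivity.

(** * Comparison of a graph with the extremal graph *)

Lemma Kgraph_spanning (G : sgraph) (p r : nat) (v : G) :
    #|vertex G| = p.+1 -> #|[set w | adj v w]| = r ->
  exists2 f : Kgraph p r -> G, bijective f &
    forall x y, adj (f x) (f y) -> adj x y.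
Proof.
move=> cardG degv; set A := [set w | adj v w] in degv.
(* List [v], then its [r] neighbours, then the rest. The extra vertex goes to [v] and clique vertex
   [i] to position [i + 1], so neighbours of [v] come from [i < r]. *)
pose s := v :: enum A ++ enum (~: (v |: A)).
have vA : v \notin A by rewrite inE adj_irr.
have s_uniq : uniq s.
  rewrite /= mem_cat !mem_enum negb_or vA !inE eqxx cat_uniq !enum_uniq andbT /=.
  apply/hasPn => w; rewrite !mem_enum !inE negb_or => /andP[_].
  by [].
have s_size : size s = p.+1.
  rewrite /= size_cat -!cardE -cardG -(cardsC (v |: A)) cardsU1 vA.
  by rewrite add1n addSn.
pose f (x : Kgraph p r) : G := if x is Some i then nth v s (i : 'I_p).+1 else v.
have f_inj : injective f.
  have nth_inj i j : i <= p -> j <= p -> nth v s i = nth v s j -> i = j.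
    by move=> ip jp /eqP; rewrite nth_uniq ?s_size // => /eqP.
  move=> [i|] [j|] //= fE.
  - by have [/val_inj ->] := nth_inj i.+1 j.+1 (ltn_ord i) (ltn_ord j) fE.
  - by have := nth_inj i.+1 0 (ltn_ord i) isT fE.
  - by have := nth_inj 0 j.+1 isT (ltn_ord j) fE.
exists f; first by apply: inj_card_bij => //; rewrite card_option card_ord cardG.
have adj_lt (i : 'I_p) : adj v (f (Some i)) -> i < r.
  rewrite ltnNge; apply: contraL => ri.
  rewrite /= nth_cat -cardE degv ltnNge ri /=.
  set w := nth _ _ _; have : w \in enum (~: (v |: A)).
    apply: mem_nth; have := ltn_ord i.
    by have := s_size; rewrite /= size_cat -cardE degv; lia.
  by rewrite mem_enum !inE negb_or => /andP[].
move=> [i|] [j|] /=; last by rewrite adj_irr.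
- by apply: contraTneq => ->; rewrite adj_irr.
- by rewrite adj_sym => /adj_lt.
- exact: adj_lt.
Qed.

Theorem theorem2p7 (R : realType) (n r : nat) (hn : 3 <= n)
    (hr : 1 <= r <= n - 2) :
  [/\ #|vertex (Kgraph (n - 1) r)| = n, connected (Kgraph (n - 1) r) &
      edge_connectivity (Kgraph (n - 1) r) = r] /\
  (forall G : sgraph,
     #|vertex G| = n -> connected G -> edge_connectivity G = r ->
     (dist_spectral_radius R (Kgraph (n - 1) r) <= dist_spectral_radius R G)%R /\
     (dist_spectral_radius R G = dist_spectral_radius R (Kgraph (n - 1) r) <->
      graph_iso G (Kgraph (n - 1) r))).
Proof.
have [r_gt0 r_lt] : 0 < r /\ r < n - 1 by lia.
have nE : n = (n - 1).+1 by lia.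
have cardK : #|vertex (Kgraph (n - 1) r)| = n by rewrite card_option card_ord -nE.
split=> [|G cardG _ ecG].
  by split; [|exact: Kgraph_connected|exact: Kgraph_edge_connectivity].
have G_gt1 : 1 < #|vertex G| by rewrite cardG; lia.
have isoP := @rho_iso R G (Kgraph (n - 1) r) G_gt1.
have [/existsP[v deg_le]|/existsPn degN] :=
    boolP [exists v : G, #|cut [set v]| <= r].
  (* The edges at [v] form a cut, so its degree is at least the edge connectivity. *)
  have degv : #|[set w | adj v w]| = r.
    apply/eqP; rewrite eqn_leq -card_cut1 deg_le -ecG /=.
    have [w wv] : exists w, w \notin [set v].
      case/card_gt1P: G_gt1 => a [b [_ _ ab]].
      have [va|va] := eqVneq a v; last by exists a; rewrite inE.
      by exists b; rewrite inE -va eq_sym.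
    exact: edge_connectivity_le_cut (set11 v) wv.
  have [|f f_bij f_adj] := @Kgraph_spanning G (n - 1) r v _ degv.
    by rewrite cardG.
  have [|le_rho eq_rho] := rho_spanning R _ f_bij f_adj; first by rewrite cardK; lia.
  by split=> //; split.
suff lt_rho : (dist_spectral_radius R (Kgraph (n - 1) r)
                 < dist_spectral_radius R G)%R.
  by split; [exact: ltW | split=> // eq_rho; rewrite eq_rho ltxx in lt_rho].
have deg (v : G) : r < #|cut [set v]| by rewrite ltnNge; exact: degN.
have [S [S_in S_out]] := edge_connectivity_cut G_gt1; rewrite ecG => cut_le.
have s_ge := card_side_of_small_cut deg S_in cut_le.
have t_ge : r.+2 <= #|~: S|.
  apply: card_side_of_small_cut deg _ _; last by rewrite card_cutC.
  by case: S_out => y yS; exists y; rewrite inE.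
have st : #|S| + #|~: S| = n by rewrite cardsC cardG.
have G_gt0 := ltnW G_gt1.
have := rho_ge_transmission R G_gt0; have := transmission_ge S.
rewrite cardG; set W := \sum_u \sum_v dist u v => W_ge le_rhoG.
(* Writing the two sides as [r + 2 + a] and [r + 2 + b], the excess is at least
   [2 r^2 + (2 r + 1)(a + b) + 2 a b], positive since [r >= 1]. *)
have W_gt : n * n + 2 * n < W + 4 by nia.
(* With [m = n - 1 - r] the bound is [n + 2 - 4 / n]; multiplied by [n] it becomes
   [n^2 + 2 n - 4]. *)
have := rho_Kgraph_le R r_gt0 (_ : 0 < n - 1 - r); rewrite subn_gt0 => /(_ r_lt).
rewrite subnKC ?(ltnW r_lt) // -nE => le_rhoK.
have n_gt0 : (0 < n%:R :> R)%R by rewrite ltr0n; lia.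
rewrite -(ltr_pM2r n_gt0); apply: lt_le_trans le_rhoG.
apply: le_lt_trans (_ : (n%:R * n%:R + 2 * n%:R - 4 < W%:R)%R); last first.
  by rewrite ltrBlDr -!natrM -!natrD ltr_nat.
apply: le_trans (_ : (_ <= (n%:R + 2 - 4 / n%:R) * n%:R)%R) _.
  by rewrite ler_pM2r.
by rewrite mulrBl mulrDl mulfVK ?gt_eqF.
Qed.
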